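(* Let $p$ be an odd prime, let $s,t\in\mathbb{N}$ with $s,t\ge 2$, and let $G\in\mathfrak{B}_{p,2,n}$, where $n\ge s\cdot t^4$. Then $G$ has either an abelian subgroup $S\le G$ such that $S[G,G]/[G,G]\cong\mathbb{Z}_p^s$, or a subgroup isomorphic to $F_{p,2,t}$.
   Context: Let $p$ be an odd prime. $\mathfrak{B}_{p,2}$ is the class of finite groups $G$ such that the commutator subgroup $[G,G]$ is contained in the centre $\mathrm{Z}(G)$ and every $g\in G$ satisfies $g^p=\mathrm{id}$. $\mathfrak{B}_{p,2,n}\subseteq\mathfrak{B}_{p,2}$ consists of those $G\in\mathfrak{B}_{p,2}$ whose minimal generating sets have size $n$, equivalently $G/[G,G]\cong\mathbb{Z}_p^n$, where $\mathbb{Z}_p$ is the cyclic group of order $p$. $F_{p,2,t}$ denotes the relatively free $p$-group of class $2$ and exponent $p$ with $t$ generators, i.e. the quotient of the free group on $t$ generators by the subgroup generated by all words of the form $x^p$ and $[[x,y],z]$ (with $x,y,z$ ranging over all elements of the free group). *)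

(* Defs.v *)
From HB Require Import structures.
From mathcomp Require Import all_boot all_order all_algebra all_fingroup.
From mathcomp Require Import all_solvable boolp.

Set Implicit Arguments.
Unset Strict Implicit.
Unset Printing Implicit Defensive.

Import GroupScope.

Section FreeGroup.

Variable T : choiceType.

(* A letter (x, false) stands for the generator x, (x, true) for x^-1; *)
(* the free group on T is the set of reduced words in these letters.   *)
Definition letter := (T * bool)%type.
Definition inv_letter (a : letter) : letter := (a.1, ~~ a.2).

Lemma inv_letterK : involutive inv_letter.
Proof. by case=> x b; rewrite /inv_letter /= negbK. Qed.

Definition no_cancel (a b : letter) : bool := b != inv_letter a.
Definition reduced (w : seq letter) : bool := sorted no_cancel w.

Definition cons_reduce (a : letter) (w : seq letter) : seq letter :=
  if w is b :: w' then if b == inv_letter a then w' else a :: w else [:: a].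

Definition mul_word (u v : seq letter) : seq letter := foldr cons_reduce v u.
Definition inv_word (u : seq letter) : seq letter := rev (map inv_letter u).

Lemma cons_reduce_reduced a w : reduced w -> reduced (cons_reduce a w).
Proof.
case: w => [|b w] //= pw; case: ifPn => [_|ba /=]; first exact: path_sorted pw.
by rewrite pw andbT.
Qed.

Lemma mul_word_reduced u v : reduced v -> reduced (mul_word u v).
Proof. by move=> rv; elim: u => //= a u IH; apply: cons_reduce_reduced. Qed.

Lemma inv_word_reduced u : reduced u -> reduced (inv_word u).
Proof.
rewrite /reduced /inv_word rev_sorted sorted_map.
apply: sub_sorted => a b; rewrite /no_cancel /relpre /= inv_letterK.
by apply: contraNneq => <-.
Qed.

Lemma cons_reduceK a w :
  reduced w -> cons_reduce (inv_letter a) (cons_reduce a w) = w.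
Proof.
case: w => [|b w] /=; first by rewrite inv_letterK eqxx.
move=> pw; case: ifPn => [/eqP ba|ba] /=; last by rewrite inv_letterK eqxx.
case: w pw => [|c w] /=; first by rewrite ba.
by rewrite ba => /andP[/negPf]; rewrite /no_cancel => ->.
Qed.

Lemma cons_reduceVK a w :
  reduced w -> cons_reduce a (cons_reduce (inv_letter a) w) = w.
Proof. by move=> rw; rewrite -{1}[a]inv_letterK cons_reduceK. Qed.

Lemma mul_cons_reduce a u w :
  reduced w -> mul_word (cons_reduce a u) w = cons_reduce a (mul_word u w).
Proof.
move=> rw; case: u => [|b u] //=; case: ifP => // /eqP->.
by rewrite cons_reduceVK //; apply: mul_word_reduced.
Qed.

Lemma mul_wordA u v w :
  reduced w -> mul_word u (mul_word v w) = mul_word (mul_word u v) w.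
Proof.
by move=> rw; elim: u => //= a u ->; rewrite mul_cons_reduce.
Qed.

Lemma mul_words1 u : reduced u -> mul_word u [::] = u.
Proof.
elim: u => //= a u IH pu; rewrite IH; last exact: path_sorted pu.
by case: u pu {IH} => //= b u /andP[/negPf]; rewrite /no_cancel => ->.
Qed.

Lemma mul_wordKV u v : reduced v -> mul_word (inv_word u) (mul_word u v) = v.
Proof.
elim: u v => //= a u IH v rv.
rewrite /inv_word /= rev_cons -cats1 /mul_word foldr_cat /=.
rewrite cons_reduceK; last exact: mul_word_reduced.
exact: IH.
Qed.

Lemma inv_wordK : involutive inv_word.
Proof.
by move=> u; rewrite /inv_word map_rev revK -map_comp map_id_in // => a _;
  rewrite /= inv_letterK.
Qed.

Record freegroup := FreeGroup {fg_word :> seq letter; _ : reduced fg_word}.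

HB.instance Definition _ := [isSub for fg_word].
HB.instance Definition _ := [Choice of freegroup by <:].

Implicit Types x y z : freegroup.

Definition fg_one : freegroup := @FreeGroup [::] isT.
Definition fg_mul x y : freegroup :=
  FreeGroup (mul_word_reduced x (valP y)).
Definition fg_inv x : freegroup := FreeGroup (inv_word_reduced (valP x)).

Lemma fg_mulA : associative fg_mul.
Proof. by move=> x y z; apply/val_inj/mul_wordA/valP. Qed.
Lemma fg_mul1 : left_id fg_one fg_mul.
Proof. by move=> x; apply/val_inj. Qed.
Lemma fg_mulx1 : right_id fg_one fg_mul.
Proof. by move=> x; apply/val_inj/mul_words1/valP. Qed.
Lemma fg_mulVx : left_inverse fg_one fg_inv fg_mul.
Proof.
move=> x; apply/val_inj; rewrite /= -[X in mul_word _ X]mul_words1 ?(valP x) //.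
exact: mul_wordKV.
Qed.
Lemma fg_mulxV : right_inverse fg_one fg_inv fg_mul.
Proof.
move=> x; have := fg_mulVx (fg_inv x); congr (fg_mul _ _ = _).
exact/val_inj/inv_wordK.
Qed.

HB.instance Definition _ :=
  isGroup.Build freegroup fg_mulA fg_mul1 fg_mulx1 fg_mulVx fg_mulxV.

Definition fg_gen (x : T) : freegroup := @FreeGroup [:: (x, false)] isT.

End FreeGroup.

(* The subgroup generated by the elements satisfying P. *)
Inductive generated (gT : groupType) (P : gT -> Prop) : gT -> Prop :=
| generated_base x : P x -> generated P x
| generated1 : generated P 1
| generatedM x y : generated P x -> generated P y -> generated P (x * y)
| generatedV x : generated P x -> generated P x^-1.

Section VerbalQuotient.

Variables (p : nat) (F : groupType).

(* The values in F of the words x^p and [[x, y], z]. *)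
Inductive law_value : F -> Prop :=
| law_exponent x : law_value (x ^+ p)
| law_class2 x y z : law_value [~ [~ x, y], z].

Definition verbal : F -> Prop := generated law_value.

Lemma law_valueJ x y : law_value x -> law_value (x ^ y).
Proof.
case=> [z|z1 z2 z3]; first by rewrite conjXg; apply: law_exponent.
by rewrite !conjRg; apply: law_class2.
Qed.

Lemma verbalJ x y : verbal x -> verbal (x ^ y).
Proof.
move=> Vx; elim: Vx => [z Vz||z1 z2 _ IH1 _ IH2|z _ IH].
- exact/generated_base/law_valueJ.
- by rewrite conj1g; apply: generated1.
- by rewrite conjMg; apply: generatedM.
- by rewrite conjVg; apply: generatedV.
Qed.

Definition verbal_rel : rel F := fun x y => `[< verbal (x^-1 * y) >].

Lemma verbal_rel_refl : reflexive verbal_rel.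
Proof. by move=> x; apply/asboolP; rewrite mulVg; apply: generated1. Qed.

Lemma verbal_rel_sym : symmetric verbal_rel.
Proof.
by move=> x y; apply/asboolP/asboolP => /generatedV;
  rewrite invgM invgK.
Qed.

Lemma verbal_rel_trans : transitive verbal_rel.
Proof.
move=> y x z /asboolP Vxy /asboolP Vyz; apply/asboolP.
by have := generatedM Vxy Vyz; rewrite mulgA mulgK.
Qed.

Canonical verbal_equiv :=
  EquivRel verbal_rel verbal_rel_refl verbal_rel_sym verbal_rel_trans.

Local Open Scope quotient_scope.

Definition verbal_quot := {eq_quot verbal_equiv}.

HB.instance Definition _ := Choice.on verbal_quot.
HB.instance Definition _ := EqQuotient.on verbal_quot.

Definition vclass (x : F) : verbal_quot := \pi_verbal_quot x.
Definition vrepr (a : verbal_quot) : F := generic_quotient.repr a.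

Lemma vreprK : cancel vrepr vclass.
Proof. exact: reprK. Qed.

Lemma vclassP x y : vclass x = vclass y <-> verbal (x^-1 * y).
Proof.
rewrite /vclass; split=> [/eqP|Vxy]; first by rewrite eqmodE => /asboolP.
by apply/eqP; rewrite eqmodE; apply/asboolP.
Qed.

Lemma vclassK x : verbal ((vrepr (vclass x))^-1 * x).
Proof. by apply/vclassP; rewrite vreprK. Qed.

Definition vq_mul (a b : verbal_quot) := vclass (vrepr a * vrepr b).
Definition vq_inv (a : verbal_quot) := vclass (vrepr a)^-1.

Lemma vq_mulE x y : vq_mul (vclass x) (vclass y) = vclass (x * y).
Proof.
apply/vclassP; move: (vrepr _) (vclassK x) (vrepr _) (vclassK y) => x' Vx y' Vy.
have := generatedM Vy (verbalJ y Vx).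
by rewrite /conjg invgM !mulgA mulgK.
Qed.

Lemma vq_invE x : vq_inv (vclass x) = vclass x^-1.
Proof.
apply/vclassP; move: (vrepr _) (vclassK x) => x' Vx.
have := verbalJ x^-1 (generatedV Vx).
by rewrite /conjg invgM !invgK !mulgA mulgV mul1g.
Qed.

Lemma vq_mulA : associative vq_mul.
Proof.
by move=> a b c; rewrite -[a]vreprK -[b]vreprK -[c]vreprK !vq_mulE mulgA.
Qed.
Lemma vq_mul1 : left_id (vclass 1) vq_mul.
Proof. by move=> a; rewrite -[a]vreprK vq_mulE mul1g. Qed.
Lemma vq_mulx1 : right_id (vclass 1) vq_mul.
Proof. by move=> a; rewrite -[a]vreprK vq_mulE mulg1. Qed.
Lemma vq_mulVx : left_inverse (vclass 1) vq_inv vq_mul.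
Proof. by move=> a; rewrite -[a]vreprK vq_invE vq_mulE mulVg. Qed.
Lemma vq_mulxV : right_inverse (vclass 1) vq_inv vq_mul.
Proof. by move=> a; rewrite -[a]vreprK vq_invE vq_mulE mulgV. Qed.

HB.instance Definition _ :=
  isGroup.Build verbal_quot vq_mulA vq_mul1 vq_mulx1 vq_mulVx vq_mulxV.

End VerbalQuotient.

(* F_{p,2,t} *)
Definition relfree (p t : nat) : groupType := verbal_quot p (freegroup 'I_t).

Definition isomorphic (gT hT : groupType) : Prop :=
  exists f : {multiplicative gT -> hT}, bijective f.

Section ClassB.

Variables (p : nat) (gT : finGroupType).

Definition class_B2 (G : {group gT}) : Prop :=
  [~: G, G] \subset 'Z(G) /\ {in G, forall g, g ^+ p = 1}.

(* Minimal for inclusion; the sizes of all such sets agree for these groups. *)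
Definition min_gen_set (G : {group gT}) (A : {set gT}) : bool :=
  minset (fun B : {set gT} => <<B>> == G) A.

Definition class_B2n (n : nat) (G : {group gT}) : Prop :=
  class_B2 G /\ forall A : {set gT}, min_gen_set G A -> #|A| = n.

End ClassB.

(* Main.v *)
(* View the commutator as an alternating bilinear map on G / [G, G].  Build
   v_1, v_2, ... in a subgroup H, centralizing a subgroup E that contains
   [G, G], so that, with U = <v_1, ..., v_k>, the next v is not in U E and
   [u, v] \in U with u \in U forces u \in E; t such elements generate a copy of
   F_{p,2,t}.  If no v in H extends the chain, every v in H satisfies
   [u, v] \in U for some u \in U \ E, so by pigeonhole some u has a centralizer
   of index at most |U|^2 <= p^(2t(t-1)) in H.  Adjoin this u to E, replace H by
   'C_H[u] and repeat: either a chain of length t appears, or E grows s times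
   and becomes the abelian subgroup. *)

Require Import Defs.
From HB Require Import structures.
From mathcomp Require Import all_boot all_order all_algebra all_fingroup.
From mathcomp Require Import all_solvable boolp.
From mathcomp Require Import zify.

Import GroupScope.

Set Implicit Arguments.
Unset Strict Implicit.
Unset Printing Implicit Defensive.

Local Notation wspan s := (Defs.generated (fun y => y \in s)).

(** * Normal forms in groups of class two and exponent p *)

Section ClassTwo.

Variables (p : nat) (R : groupType).
Hypothesis p_pr : prime p.
Hypothesis R_exp : forall x : R, x ^+ p = 1.
Hypothesis R_cl2 : forall x y z : R, commute [~ x, y] z.

Implicit Types (x y z v : R) (xs : seq R).

Lemma cl2_commMg x y z : [~ x * y, z] = [~ x, z] * [~ y, z].
Proof.
have /conjg_fixP <- : [~ [~ x, z], y] == 1 by apply/commgP/R_cl2.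
by rewrite !commgEr conjgM mulgA -conjMg mulgK.
Qed.

Lemma cl2_commVg x z : [~ x^-1, z] = [~ x, z]^-1.
Proof. by apply/esym/mulg1_eq; rewrite -cl2_commMg mulgV comm1g. Qed.

Lemma cl2_commXg x z n : [~ x ^+ n, z] = [~ x, z] ^+ n.
Proof. by elim: n => [|n IH]; rewrite ?comm1g // !expgS cl2_commMg IH. Qed.

Lemma generatedX (P : R -> Prop) x n :
  Defs.generated P x -> Defs.generated P (x ^+ n).
Proof.
move=> Px; elim: n => [|n IH]; first exact: Defs.generated1.
by rewrite expgS; apply: Defs.generatedM.
Qed.

(** Elements of this form are closed under products: reordering the factors produces only central
    commutators, and these merge by bilinearity into a single [[~ y', v]]. *)
Lemma cl2_normal_form xs v x :
  wspan (v :: xs) x ->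
  exists y b y', [/\ wspan xs y,
    wspan xs y' & x = y * v ^+ b * [~ y', v]].
Proof.
pose N x := exists y b y', [/\ wspan xs y,
    wspan xs y' & x = y * v ^+ b * [~ y', v]].
have N1 : N 1.
  by exists 1, 0, 1; split; rewrite ?comm1g ?mulg1 //; apply: Defs.generated1.
have NM x1 x2 : N x1 -> N x2 -> N (x1 * x2).
  move=> [y1 [b1 [z1 [gy1 gz1 ->]]]] [y2 [b2 [z2 [gy2 gz2 ->]]]].
  (* Moving [y2] left across [v ^+ b1] costs [[~ v ^+ b1, y2]], which bilinearity turns into
     [[~ y2^-1 ^+ b1, v]]. *)
  exists (y1 * y2), (b1 + b2)%N, (y2 ^-1 ^+ b1 * (z1 * z2)); split.
  - exact: Defs.generatedM.
  - by do 2?apply: Defs.generatedM; rewrite //;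
      apply/generatedX/Defs.generatedV.
  have -> : [~ y2^-1 ^+ b1 * (z1 * z2), v] =
      [~ v ^+ b1, y2] * ([~ z1, v] * [~ z2, v]).
    by rewrite !cl2_commMg // !cl2_commXg // cl2_commVg // invgR.
  move: (R_cl2 z1 v) (R_cl2 (v ^+ b1) y2) (commgC (v ^+ b1) y2).
  move: [~ z1, v] [~ z2, v] [~ v ^+ b1, y2] => c1 c2 d c1C dC vy.
  rewrite expgnDr -!mulgA; congr (_ * _).
  rewrite (mulgA c1 y2) (c1C y2) -mulgA [v ^+ b1 * _]mulgA vy -!mulgA.
  congr (_ * (_ * _)); move: (v ^+ b2) => w.
  by rewrite (mulgA c1 w) (c1C w) -mulgA (mulgA d w) (dC w) -mulgA.
elim=> {x} [x|//|x y _ + _|x _ Nx]; last 2 first.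
- exact: NM.
(* In exponent p an inverse is a power, so closure under products suffices. *)
- suff -> : x^-1 = x ^+ p.-1.
    by elim: p.-1 => [|n IH] //; rewrite expgS; apply: NM.
  by apply: mulg1_eq; rewrite -expgS prednK ?prime_gt0.
rewrite inE => /predU1P[->|xs_x].
  exists 1, 1%N, 1; split; rewrite ?comm1g ?mulg1 ?mul1g //;
  exact: Defs.generated1.
exists x, 0, 1; split; rewrite ?comm1g ?mulg1 //; last exact: Defs.generated1.
exact: Defs.generated_base.
Qed.

End ClassTwo.

(** * Chains and injectivity of homomorphisms onto them *)

Section FreeChain.

Variable gT : finGroupType.
(* The head of the sequence is the vector added last. *)
Fixpoint free_chain (E : {group gT}) (e : seq gT) : Prop :=
  if e is v :: e' then
    [/\ free_chain E e', v \notin <<[set x in e']>> <*> E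
      & {in <<[set x in e']>>, forall u,
           [~ u, v] \in <<[set x in e']>> -> u \in E}]
  else True.

Lemma generated_gmulf (R : groupType) (f : UMagmaMorphism.type R gT) xs x :
  wspan xs x -> f x \in <<[set y in map f xs]>>.
Proof.
elim=> {x} [x xs_x||x y _ fx _ fy|x _ fx].
- by apply: mem_gen; rewrite inE map_f.
- by rewrite gmulf1 group1.
- by rewrite gmulfM groupM.
- by rewrite gmulfV groupV.
Qed.

(* The second conclusion makes the induction work: with x = y v^b [z, v],
   f x = 1 gives v^b = 1 and [f z, f v] = (f y)^-1, so f z \in E by the chain
   condition, hence z is central and x = y. *)
Lemma free_chain_inj (p : nat) (R : groupType) (f : UMagmaMorphism.type R gT)
    (E : {group gT}) (xs : seq R) :
  prime p -> (forall x : R, x ^+ p = 1) ->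
  (forall x y z : R, commute [~ x, y] z) ->
  (forall x y : R, [~ f x, f y] \in E) ->
  free_chain E (map f xs) ->
  forall x, wspan xs x ->
    (f x = 1 -> x = 1) /\ (f x \in E -> forall y, commute x y).
Proof.
move=> p_pr Rp R2 fE.
have f1 : f 1 = 1 := gmulf1.
have fM x y : f (x * y) = f x * f y := gmulfM x y.
have fX x n : f (x ^+ n) = f x ^+ n := gmulfXn f n x.
have fR x y : f [~ x, y] = [~ f x, f y] := gmulfR f x y.
elim: xs => [_|v xs IH /= [/IH{}IH vE uE]] x.
  suff xs0 z : wspan (Nil R) z -> z = 1.
    by move=> /xs0 ->; split=> // _ y; apply/commute_sym/commute1.
  by elim=> {z} // [z1 z2 _ -> _ ->|z _ ->]; rewrite ?mulg1 ?invg1.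
case/(cl2_normal_form p_pr Rp R2) => y [b [z [gy gz ->]]].
have fy := generated_gmulf f gy; have fz := generated_gmulf f gz.
have [IHy1 IHyE] := IH y gy; have [_ IHzE] := IH z gz.
have vb1 : f (y * v ^+ b * [~ z, v]) \in E -> v ^+ b = 1.
  rewrite fM fR groupMr // fM fX => yvE.
  (* If p did not divide b, Bezout would make [f v] a power of [f v ^+ b], hence a member of the
     join that [vE] excludes. *)
  have /dvdnP[c ->] : p %| b; last by rewrite mulnC expgnA Rp expg1n.
  apply: contraNT vE => p'b.
  have vbJ : f v ^+ b \in <<[set x in map f xs]>> <*> E.
    rewrite -(groupMl _ (_ : f y \in _)).
      exact: (subsetP (joing_subr _ _)).
    exact: (subsetP (joing_subl _ _)).
  have b_gt0 : (0 < b)%N.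
    by rewrite lt0n; apply: contraNneq p'b => ->; rewrite dvdn0.
  case: (egcdnP p b_gt0) => kb kp def_kb _.
  have /eqP cop : coprime b p by rewrite coprime_sym prime_coprime.
  suff -> : f v = (f v ^+ b) ^+ kb by apply: groupX.
  rewrite -expgnA mulnC def_kb cop expgnDr mulnC expgnA -[f v ^+ p]fX Rp.
  by rewrite f1 expg1n mul1g.
split=> [fx1 | fE1].
  have vb : v ^+ b = 1 by apply: vb1; rewrite fx1.
  move: fx1; rewrite vb mulg1 fM fR => fx1.
  have zE : f z \in E.
    apply: uE => //; suff -> : [~ f z, f v] = (f y)^-1 by rewrite groupV.
    by rewrite -(mulKg (f y) [~ _, _]) fx1 mulg1.
  have zv : [~ z, v] = 1 by apply/eqP/commgP/IHzE.
  rewrite zv mulg1; apply: IHy1; move: fx1.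
  by rewrite -fR zv f1 mulg1.
(* [E] absorbs the commutator, so [f y] lies in [E] and [y] is central by induction; [[~ z, v]] is
   central by class two. *)
have vb := vb1 fE1.
move: fE1; rewrite vb mulg1 fM fR groupMr // => yE w.
by apply/commute_sym/commuteM/commute_sym/R2; apply/commute_sym/IHyE.
Qed.

End FreeChain.

(** * The relatively free group *)

Section Lift.

Variables (T : choiceType) (K : groupType) (h : T -> K).

Definition letter_val (a : letter T) : K := if a.2 then (h a.1)^-1 else h a.1.
Definition word_val (w : seq (letter T)) : K := \prod_(a <- w) letter_val a.

Lemma letter_valV a : letter_val (inv_letter a) = (letter_val a)^-1.
Proof. by case: a => x []; rewrite /letter_val //= invgK. Qed.

(** Inverse letters have inverse values, so the cancellations made by [cons_reduce] preserve the
    value. *)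
Lemma word_val_mul u v : word_val (mul_word u v) = word_val u * word_val v.
Proof.
rewrite /word_val; elim: u => [|a u IH] /=; first by rewrite big_nil mul1g.
rewrite big_cons -mulgA -IH; case: (mul_word u v) => [|b w] /=.
  by rewrite !big_cons.
case: eqP => [->|_]; last by rewrite !big_cons.
by rewrite big_cons letter_valV mulKVg.
Qed.

Definition fg_lift (x : freegroup T) : K := word_val x.

Lemma fg_lift_morphism : monoid_morphism fg_lift.
Proof. by split=> [|x y]; [apply: big_nil | apply: word_val_mul]. Qed.

HB.instance Definition _ :=
  isUMagmaMorphism.Build (freegroup T) K fg_lift fg_lift_morphism.

Lemma fg_lift_gen i : fg_lift (fg_gen i) = h i.
Proof. exact: big_seq1. Qed.

(** Prefixing the first letter of a reduced word to its tail cancels nothing, so the word is the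
    product of the two. *)
Lemma generated_fg_gen (x : freegroup T) :
  Defs.generated (fun y => exists i, y = fg_gen i) x.
Proof.
case: x => w; elim: w => [|a w IH] rw.
  by rewrite (_ : FreeGroup rw = 1); [apply: Defs.generated1 | apply: val_inj].
have rw' : reduced w := path_sorted rw.
have -> : FreeGroup rw = FreeGroup (isT : reduced [:: a]) * FreeGroup rw'.
  apply: val_inj => /=; case: (w) rw => //= b v /andP[/negPf].
  by rewrite /no_cancel => ->.
apply: Defs.generatedM => //; case: a {rw} => i [].
  have -> : FreeGroup (isT : reduced [:: (i, true)]) = (fg_gen i)^-1.
    exact: val_inj.
  by apply/Defs.generatedV/Defs.generated_base; exists i.
by apply: Defs.generated_base; exists i; apply: val_inj.
Qed.

End Lift.

Section RelFree.

Variables p t : nat.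

Definition relfree_gen (i : 'I_t) : relfree p t := vclass p (fg_gen i).

Lemma relfree_exp (x : relfree p t) : x ^+ p = 1.
Proof.
have vX n y : (vclass p y : relfree p t) ^+ n = vclass p (y ^+ n).
  elim: n => [|n IH] //; rewrite !expgS IH; exact: vq_mulE.
rewrite -[x]vreprK vX; apply/vclassP; rewrite mulg1.
by apply/Defs.generatedV/Defs.generated_base/law_exponent.
Qed.

Lemma relfree_cl2 (x y z : relfree p t) : commute [~ x, y] z.
Proof.
apply/commgP/eqP; rewrite -[x]vreprK -[y]vreprK -[z]vreprK.
have vR u v : [~ vclass p u, vclass p v] = vclass p [~ u, v] :> relfree p t.
  by rewrite /commg /conjg /mulg /invg /= !vq_invE !vq_mulE.
rewrite (vR (vrepr x) (vrepr y)) (vR [~ vrepr x, _] (vrepr z)).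
apply/vclassP; rewrite mulg1.
by apply/Defs.generatedV/Defs.generated_base/law_class2.
Qed.

Lemma generated_relfree_gen (x : relfree p t) :
  wspan [seq relfree_gen i | i <- enum 'I_t] x.
Proof.
rewrite -[x]vreprK; elim: (generated_fg_gen (vrepr x)) => {x}.
- move=> _ [i ->]; apply/Defs.generated_base/map_f; exact: mem_enum.
- exact: Defs.generated1.
- by move=> x y _ IHx _ IHy; rewrite -vq_mulE; apply: Defs.generatedM.
- by move=> x _ IHx; rewrite -vq_invE; apply: Defs.generatedV.
Qed.

(** The universal property of F_{p,2,t}: the lift from the free group kills both laws, hence
    [verbal], so its value on [vrepr a] depends only on the class [a]. *)
Lemma relfree_lift (K : groupType) (h : 'I_t -> K) :
  (forall x : K, x ^+ p = 1) -> (forall x y z : K, commute [~ x, y] z) ->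
  exists f : UMagmaMorphism.type (relfree p t) K,
    forall i, f (relfree_gen i) = h i.
Proof.
move=> Kp K2; pose f0 := fg_lift h.
have f0M x y : f0 (x * y) = f0 x * f0 y := gmulfM x y.
have f0i x : f0 x^-1 = (f0 x)^-1 := gmulfV _ x.
have f0V x : verbal p x -> f0 x = 1.
  elim=> {x} [x|||].
  - case=> [y|y z w]; first by rewrite /f0 gmulfXn Kp.
    by rewrite /f0 !gmulfR; apply/eqP/commgP.
  - exact: gmulf1.
  - by move=> x y _ fx _ fy; rewrite f0M fx fy mulg1.
  - by move=> x _ fx; rewrite f0i fx invg1.
pose f (a : relfree p t) := f0 (vrepr a).
have fE x : f (vclass p x) = f0 x.
  have := f0V _ (vclassK p x); rewrite f0M f0i => fx.
  by rewrite -[RHS](mulKVg (f (vclass p x))) fx mulg1.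
have f_morph : monoid_morphism f.
  split=> [|a b]; first by rewrite fE; apply: gmulf1.
  rewrite -[a]vreprK -[b]vreprK -[_ * _]/(vq_mul _ _) vq_mulE !fE.
  exact: f0M.
pose F := HB.pack_for (UMagmaMorphism.type (relfree p t) K) f
  (isUMagmaMorphism.Build _ _ f f_morph).
by exists F => i; rewrite /= fE; apply: fg_lift_gen.
Qed.

End RelFree.

(** The universal property sends the free generators to the chain; [free_chain_inj] gives
    injectivity, and the image contains generators of the subgroup. *)
Lemma free_chain_relfree (p t : nat) (gT : finGroupType) (G E : {group gT})
    (e : seq gT) :
  prime p -> class_B2 p G -> [~: G, G] \subset E -> {subset e <= G} ->
  size e = t -> free_chain E e ->
  isomorphic (subg_of <<[set x in e]>>) (relfree p t).
Proof.
move=> p_pr [G2 Gp] GE eG et Ee; set H := <<_>>%G.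
have HG : H \subset G.
  by rewrite gen_subG; apply/subsetP=> x; rewrite inE => /eG.
have HGr (x : subg_of H) : sgval x \in G by apply: (subsetP HG); apply: subgP.
have sgV1 (x : subg_of H) : sgval x = 1 -> x = 1 by move=> x1; apply: val_inj.
have sgR (x y : subg_of H) : sgval [~ x, y] = [~ sgval x, sgval y] by [].
have sgX (x : subg_of H) n : sgval (x ^+ n) = sgval x ^+ n.
  by elim: n => [|n IH] //; rewrite !expgS -IH.
pose h (i : 'I_t) := subg H (nth 1 e i).
have [f fh] : exists f : UMagmaMorphism.type (relfree p t) (subg_of H),
    forall i, f (relfree_gen p i) = h i.
  apply: relfree_lift => [x|x y z]; first by apply: sgV1; rewrite sgX Gp.
  apply/commgP/eqP/sgV1; rewrite sgR; apply/eqP/commgP.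
  apply: (centP (subsetP (subset_trans G2 (subsetIr _ _)) _ _)) => //.
  by rewrite sgR mem_commg.
(* Chains live in [gT], so [f] is composed with the inclusion of [H] before [free_chain_inj] is
   applied. *)
have f1_morph : monoid_morphism (fun a => sgval (f a)).
  by split=> [|a b]; rewrite /= ?gmulf1 ?gmulfM.
pose f1 := HB.pack_for (UMagmaMorphism.type (relfree p t) gT)
  (fun a => sgval (f a))
  (isUMagmaMorphism.Build _ _ (fun a => sgval (f a)) f1_morph).
have f1e : map f1 [seq relfree_gen p i | i <- enum 'I_t] = e.
  rewrite -map_comp -[RHS](mkseq_nth 1) et /mkseq -val_enum_ord -map_comp.
  apply: eq_map => i /=; rewrite fh subgK //.
  by apply: mem_gen; rewrite inE mem_nth // et.
have f_inj : injective f.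
  apply: gmulf_inj => x fx.
  have f1x : f1 x = 1 by rewrite /= fx.
  have := free_chain_inj (f := f1) (E := E)
    (xs := [seq relfree_gen p i | i <- enum 'I_t]) p_pr.
  case/(_ _ _ _ _ x) => //; last by move=> ->.
  - exact: relfree_exp.
  - exact: relfree_cl2.
  - by move=> y z; apply: (subsetP GE); rewrite mem_commg ?HGr.
  - by rewrite f1e.
  - exact: generated_relfree_gen.
have f_surj y : exists x, f x = y.
  (* The image of [f1], cut out by a classical test since [relfree p t] is not given as a finite
     type. *)
  pose I := [set x | `[< exists a, f1 a = x >]].
  have gI : group_set I.
    apply/group_setP; split=> [|x z].
      by rewrite inE; apply/asboolP; exists 1; apply: gmulf1.
    rewrite !inE => /asboolP[a <-] /asboolP[b <-]; apply/asboolP.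
    by exists (a * b); apply: gmulfM.
  have HI : H \subset Group gI.
    rewrite gen_subG; apply/subsetP=> x; rewrite inE -f1e => /mapP[a _ ->].
    by rewrite inE; apply/asboolP; exists a.
  have := subsetP HI _ (subgP y); rewrite inE => /asboolP[a f1a].
  by exists a; apply: val_inj.
(* [isomorphic] asks for a map out of the subgroup, so the inverse of [f] is taken. *)
have [g gK] := boolp.choice f_surj.
have fK : cancel f g by apply: inj_can_sym.
pose g1 := HB.pack_for {multiplicative subg_of H -> relfree p t} g
  (isMultiplicative.Build _ _ g (can2_gmulfM fK gK)).
by exists g1; exists f.
Qed.

(** * Counting *)

Section Counting.

Variables (p : nat) (gT : finGroupType) (G : {group gT}).
Hypotheses (p_pr : prime p) (G_B2 : class_B2 p G).

Lemma class_B2_pgroup : p.-group G.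
Proof.
apply/pgroupP=> q q_pr /Cauchy[] // x Gx ox; apply/eqP.
by apply/eqP; rewrite -(dvdn_prime2 q_pr p_pr) -ox order_dvdn G_B2.2.
Qed.

Lemma card_gen_abelian (hT : finGroupType) (A : {set hT}) :
  abelian A -> {in <<A>>, forall x, x ^+ p = 1} -> (#|<<A>>| <= p ^ #|A|)%N.
Proof.
move=> abA Ap; have abelA : p.-abelem <<A>>.
  by apply/abelemP => //; split=> //; rewrite abelian_gen.
rewrite (card_pgroup (abelem_pgroup abelA)) leq_exp2l ?prime_gt1 //.
by rewrite -rank_abelem // -grank_abelian ?abelian_gen //; apply: grank_min.
Qed.

(** [[~: A, A]] is central and generated by at most |A|^2 commutators; modulo it the generators in A
    commute. Both layers are elementary abelian. *)
Lemma card_gen_class2 (A : {set gT}) :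
  A \subset G -> (#|<<A>>| <= p ^ (#|A| + #|A| ^ 2))%N.
Proof.
case: G_B2 => G2 Gp sAG.
have sAG' : <<A>> \subset G by rewrite gen_subG.
pose K := [~: A, A]%G.
have KG : K \subset [~: G, G] := commgSS sAG sAG.
have KZ : K \subset 'Z(G) := subset_trans KG G2.
have cKG : G \subset 'C(K) by rewrite centsC (subset_trans KZ) ?subsetIr.
have nKA : <<A>> \subset 'N(K) by rewrite (subset_trans sAG') // cents_norm.
have sKA : K \subset <<A>> by apply: comm_subG; apply: subset_gen.
rewrite -(Lagrange sKA) -card_quotient // addnC expnD leq_mul //.
  have cK : abelian K.
    by rewrite /abelian (subset_trans _ cKG) // (subset_trans sKA).
  apply: leq_trans (card_gen_abelian _ _) _.
  - by rewrite -abelian_gen.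
  - by move=> x Kx; apply/Gp/(subsetP sAG')/(subsetP sKA).
  by rewrite leq_exp2l ?prime_gt1 // -mulnn /commg_set curry_imset2X -cardsX
    leq_imset_card.
rewrite quotient_gen; last exact: subset_trans (subset_gen _) nKA.
apply: leq_trans (card_gen_abelian _ _) _.
- rewrite /abelian quotient_cents2 //; exact: subset_trans (subset_gen _) nKA.
- rewrite -quotient_gen; last exact: subset_trans (subset_gen _) nKA.
  move=> _ /morphimP[x Nx Ax ->]; rewrite -morphX //= Gp ?morph1 //.
  exact: (subsetP sAG').
by rewrite leq_exp2l ?prime_gt1 // leq_quotient.
Qed.

(** Since [u, v] = u^-1 u^v, a nonempty fibre lies in a single right coset of ['C_H[u]]. *)
Lemma card_commg_fiber (H : {group gT}) u w :
  (#|[set v in H | [~ u, v] == w]| <= #|'C_H[u]|)%N.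
Proof.
have [->|[v0]] := set_0Vmem [set v in H | [~ u, v] == w].
  by rewrite cards0.
rewrite inE => /andP[Hv0 /eqP uv0].
rewrite -(card_rcoset 'C_H[u] v0); apply/subset_leq_card/subsetP=> v.
rewrite inE mem_rcoset => /andP[Hv /eqP uv].
rewrite inE groupM ?groupV //=; apply/cent1P/commute_sym/commgP.
rewrite -conjg_fix conjgM; apply/eqP/(canLR (conjgK _)).
by apply: (mulgI u^-1); rewrite -!commgEl uv uv0.
Qed.

(* Each v in H failing the first alternative lies in one of the at most
   |U|^2 sets {v | [u, v] = w} with u in U \ E and w in U. *)
Lemma extend_or_centralizer (H E U : {group gT}) :
  E \subset H -> H \subset 'C(E) -> U \subset H -> ~~ (H \subset E) ->
  (exists v, [/\ v \in H, v \notin U <*> E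
      & {in U, forall u, [~ u, v] \in U -> u \in E}]) \/
  (exists2 u, u \in H :\: E & (#|H| <= #|'C_H[u]| * #|U| ^ 2)%N).
Proof.
move=> sEH cHE sUH HnE.
(* If U lies in E, the commutator condition is automatic and any v in H outside E works. *)
have [sUE|] := boolP (U \subset E).
  have [v Hv Ev] := subsetPn HnE; left; exists v; split=> //.
    by rewrite (joing_idPr sUE).
  by move=> u /(subsetP sUE).
case/subsetPn=> u0 Uu0 Eu0.
have [/exists_inP[v Hv /forall_inP Uv]|noV] :=
    boolP [exists v in H, [forall u in U, ([~ u, v] \in U) ==> (u \in E)]].
  left; exists v; split=> //; last by move=> u /Uv/implyP.
  (* If v = u z with u in U and z in E, then [u, v] = 1 forces u, hence v, into E; so v centralizes
     [u0], which puts [u0] in E, a contradiction. *)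
  have cUE : E \subset 'C(U) by rewrite centsC (subset_trans sUH).
  apply: contra Eu0; rewrite (cent_joinEr cUE) => /imset2P[u z Uu Ez def_v].
  have Eu : u \in E.
    apply: (implyP (Uv u Uu)); suff -> : [~ u, v] = 1 by apply: group1.
    apply/eqP/commgP; rewrite def_v; apply: commuteM => //.
    exact/commute_sym/(centP (subsetP cUE z Ez)).
  apply: (implyP (Uv u0 Uu0)); suff -> : [~ u0, v] = 1 by apply: group1.
  apply/eqP/commgP/commute_sym; apply: (centP (subsetP cUE v _)) => //.
  by rewrite def_v groupM.
right; have Du0 : u0 \in U :\: E by rewrite inE Eu0.
(* Choosing u with the largest centralizer bounds every fibre by the same number. *)
case: (@arg_maxnP _ u0 (mem (U :\: E)) (fun u => #|'C_H[u]|) Du0) => u Du maxu.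
exists u; first by case/setDP: Du => /(subsetP sUH) Hu Eu; rewrite inE Eu.
pose fib (x : gT * gT) := [set v in H | [~ x.1, v] == x.2].
pose P := [set fib x | x in setX (U :\: E) U].
have sHP : H \subset cover P.
  apply/subsetP=> v Hv; rewrite negb_exists_in in noV.
  have := forall_inP noV v Hv; rewrite negb_forall_in => /exists_inP[w Uw].
  rewrite negb_imply => /andP[Uwv Ew]; apply/bigcupP.
  exists (fib (w, [~ w, v])).
    by apply: imset_f; rewrite !inE /= Ew Uw.
  by rewrite inE Hv eqxx.
apply: leq_trans (subset_leq_card sHP) _.
apply: leq_trans (leq_card_cover P).1 _.
have leP B : B \in P -> (#|B| <= #|'C_H[u]|)%N.
  case/imsetP=> [[w z]] /setXP[/= Dw _] ->.
  exact: leq_trans (card_commg_fiber _ _ _) (maxu _ Dw).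
apply: (@leq_trans (\sum_(B in P) #|'C_H[u]|)); first exact: leq_sum.
rewrite sum_nat_const mulnC leq_mul2l.
apply/orP; right; apply: leq_trans (leq_imset_card _ _) _.
by rewrite cardsX -mulnn leq_mul2r subset_leq_card ?orbT ?subsetDl.
Qed.

(** A chain of k elements spans U with |U| <= p^(k + k^2), so |U|^2 <= p^(2(k + 1)k), the bound for
    k + 1. The bound grows with k, so a centralizer found early still serves. *)
Lemma chain_or_centralizer (k : nat) (H E : {group gT}) :
  H \subset G -> E \subset H -> H \subset 'C(E) -> ~~ (H \subset E) ->
  (exists e : seq gT, [/\ size e = k, {subset e <= H} & free_chain E e]) \/
  (exists2 u, u \in H :\: E & (#|H| <= #|'C_H[u]| * p ^ (2 * (k * k.-1)))%N).
Proof.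
move=> sHG sEH cHE HnE; elim: k => [|k [[e [ek eH Ee]]|[u Du leu]]].
- by left; exists [::].
- have sUH : <<[set x in e]>> \subset H.
    by rewrite gen_subG; apply/subsetP=> x; rewrite inE => /eH.
  have [[v [Hv vE vU]]|[u Du leu]] := extend_or_centralizer sEH cHE sUH HnE.
    left; exists (v :: e); split=> //=; first by rewrite ek.
    by move=> x; rewrite inE => /predU1P[->|/eH].
  right; exists u => //; apply: leq_trans leu _.
  rewrite leq_mul2l; apply/orP; right.
  rewrite [(2 * _)%N]mulnC expnM leq_exp2r //.
  apply: leq_trans (card_gen_class2 _) _.
    by apply/subsetP=> x; rewrite inE => /eH/(subsetP sHG).
  rewrite leq_exp2l ?prime_gt1 //= mulSn mulnn.
  by rewrite leq_add ?leq_exp2r // cardsE -ek card_size.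
right; exists u => //; apply: leq_trans leu _.
rewrite leq_mul2l leq_exp2l ?prime_gt1 //; apply/orP; right.
by rewrite leq_mul2l leq_mul ?leq_pred.
Qed.

(** Each round multiplies |E| by p and divides |H| by at most p^(2t(t - 1)), which explains the
    exponent per unit of s. E stays abelian because it lies in H, which centralizes it. *)
Lemma chain_or_abelian (t s : nat) (H E : {group gT}) :
  H \subset G -> E \subset H -> H \subset 'C(E) -> [~: G, G] \subset E ->
  (#|E| * p ^ (s * (2 * (t * t.-1)).+1) <= #|H|)%N ->
  (exists (E' : {group gT}) (e : seq gT),
     [/\ [~: G, G] \subset E', size e = t, {subset e <= G}
       & free_chain E' e]) \/
  (exists S : {group gT},
     [/\ S \subset G, [~: G, G] \subset S, abelian S
       & #|S| = (#|E| * p ^ s)%N]).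
Proof.
elim: s H E => [|s IH] H E sHG sEH cHE sDE leH.
  right; exists E; split; rewrite ?muln1 //.
    exact: subset_trans sHG.
  exact: subset_trans cHE.
have p_gt1 := prime_gt1 p_pr.
have HnE : ~~ (H \subset E).
  apply: contraL leH => /subset_leq_card leHE.
  rewrite -ltnNge (leq_ltn_trans leHE) //.
  by rewrite -[X in (X < _)%N]muln1 ltn_pmul2l ?cardG_gt0 //
    mulSn addSn -{1}(expn0 p) ltn_exp2l.
have [[e [et eH Ee]]|[u /setDP[Hu Eu] leu]] :=
  chain_or_centralizer t sHG sEH cHE HnE.
  by left; exists E, e; split=> // x /eH/(subsetP sHG).
have cuE : <[u]> \subset 'C(E) by rewrite cycle_subG (subsetP cHE).
have ou : #[u] = p.
  have u1 : #[u] != 1%N by rewrite order_eq1; apply: contraNneq Eu => ->.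
  by apply/(prime_nt_dvdP p_pr u1); rewrite order_dvdn G_B2.2 ?(subsetP sHG).
(* [<[u]>] has prime order and u is outside E, so the two commuting factors meet trivially. *)
have cardE1 : #|E <*> <[u]>| = (#|E| * p)%N.
  rewrite cent_joinEr // TI_cardMg -?orderE ?ou //.
  rewrite setIC prime_TIg -?orderE ?ou //.
  by rewrite cycle_subG.
have sE1 : E <*> <[u]> \subset 'C_H[u].
  rewrite join_subG cycle_subG inE Hu cent1id andbT subsetI sEH /=.
  by rewrite sub_cent1 (subsetP cHE).
have [| | | | |chain|[S [SG DS abS cardS]]] := IH 'C_H[u]%G (E <*> <[u]>)%G.
- by rewrite (subset_trans (subsetIl _ _)).
- exact: sE1.
- rewrite /= centY subsetI (subset_trans (subsetIl _ _)) //=.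
  by rewrite cent_cycle subsetIr.
- exact: subset_trans (joing_subl _ _).
- rewrite /= cardE1; move: leH; rewrite mulSn expnD => leH.
  rewrite -(@leq_pmul2r (p ^ (2 * (t * t.-1)))) ?expn_gt0 ?prime_gt0 //.
  apply: leq_trans leu; apply: leq_trans leH.
  by rewrite expnS -!mulnA leq_mul2l [(p ^ (s * _) * _)%N]mulnC !mulnA
    leqnn orbT.
- by left.
right; exists S; split=> //.
by rewrite cardS cardE1 -mulnA -expnS.
Qed.

End Counting.

(** * The order of G, and the conclusion *)

(** Exponent p makes the Frattini subgroup equal to [G, G]. A generating set of least size is also
    minimal for inclusion, so n is the rank of the elementary abelian Frattini quotient. *)
Lemma card_class_B2n (p n : nat) (gT : finGroupType) (G : {group gT}) :
  prime p -> class_B2n p n G -> #|G| = (#|[~: G, G]| * p ^ n)%N.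
Proof.
move=> p_pr [G_B2 min_n]; have pG := class_B2_pgroup p_pr G_B2.
have [_ Gp] := G_B2.
have PhiG : 'Phi(G) = [~: G, G].
  rewrite (Phi_joing pG) [X in _ <*> X](_ : _ = 1) ?joingG1 //.
  apply/trivgP; rewrite /= (MhoE 1 pG) gen_subG.
  by apply/subsetP=> _ /imsetP[x Gx ->]; rewrite inE expn1 Gp.
have nPhi : G \subset 'N('Phi(G)) := normal_norm (Phi_normal G).
have abE := Phi_quotient_abelem pG.
have mE : 'm(G / 'Phi(G)) = logn p #|G / 'Phi(G)|.
  by rewrite grank_abelian ?(abelem_abelian abE) // (rank_abelem abE).
have min_grank (A : {set gT}) : <<A>> = G -> #|A| = 'm(G) -> n = #|A|.
  move=> genA cardA; apply/esym/min_n/minsetP; split; first exact/eqP.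
  move=> B /eqP genB sBA; apply/eqP; rewrite eqEcard sBA cardA.
  by rewrite -genB grank_min.
have nm : n = 'm(G).
  by have [A genA cardA] := grank_witness G; rewrite (min_grank A).
(* Burnside basis theorem: representatives of generators of the quotient generate G, as Frattini
   elements are non-generators. *)
have mPhi : 'm(G) = 'm(G / 'Phi(G)).
  apply/eqP; rewrite eqn_leq quotient_grank // andbT.
  have [B genB <-] := grank_witness (G / 'Phi(G)).
  pose A := [set repr (b : coset_of _) | b in B].
  have sBG : B \subset G / 'Phi(G) by rewrite -genB subset_gen.
  have sAG : A \subset G.
    apply/subsetP=> _ /imsetP[b Bb ->].
    have : repr b \in coset 'Phi(G) @*^-1 (G / 'Phi(G)).
      by rewrite inE repr_coset_norm inE /= coset_reprK (subsetP sBG).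
    by rewrite quotientGK ?Phi_normal.
  have sBA : B \subset A / 'Phi(G).
    apply/subsetP=> b Bb; rewrite -(coset_reprK b).
    by apply: mem_morphim; [apply: repr_coset_norm | apply: imset_f].
  have genA : <<A>> = G.
    apply: Phi_nongen; apply/eqP; rewrite eqEsubset join_subG Phi_sub sAG /=.
    rewrite -(quotientSGK nPhi) ?joing_subl // -genB gen_subG.
    exact: subset_trans (quotientS _ (joing_subr _ _)).
  by have := grank_min A; rewrite genA => /leq_trans -> //;
    apply: leq_imset_card.
rewrite -PhiG -(Lagrange (Phi_sub G)) -card_quotient // nm mPhi mE.
by rewrite -(card_pgroup (abelem_pgroup abE)).
Qed.

Theorem corollary4p2 (p s t n : nat) (gT : finGroupType) (G : {group gT}) :
  prime p -> odd p -> (2 <= s)%N -> (2 <= t)%N ->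
  class_B2n p n G -> (s * t ^ 4 <= n)%N ->
  (exists S : {group gT},
     [/\ S \subset G, abelian S &
         (S * [~: G, G]) / [~: G, G] \isog [set: 'rV['Z_p]_s]])
  \/ (exists H : {group gT},
        H \subset G /\ isomorphic (subg_of H) (relfree p t)).
Proof.
move=> p_pr _ _ t_ge2 G_B2n le_n; have [G_B2 _] := G_B2n.
have [G2 Gp] := G_B2; have p_gt1 := prime_gt1 p_pr.
have cGD : G \subset 'C([~: G, G]).
  by rewrite centsC (subset_trans G2) ?subsetIr.
(* The iteration starts from H = G and the central subgroup E = [G, G]. *)
have [|||||[E [e [DE et eG Ee]]]|[S [SG DS abS cardS]]] :=
    @chain_or_abelian p gT G p_pr G_B2 t s G [~: G, G]%G.
- by [].
- exact: comm_subG.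
- exact: cGD.
- by [].
(* After cancelling |[G, G]|, the base p and s, what remains is 2t(t - 1) + 1 <= t^4. *)
- rewrite (card_class_B2n p_pr G_B2n) leq_mul2l leq_exp2l //.
  apply/orP; right; apply: leq_trans le_n; rewrite leq_mul2l; apply/orP; right.
  nia.
- right; exists <<[set x in e]>>%G; split.
    by rewrite gen_subG; apply/subsetP=> x; rewrite inE => /eG.
  exact: free_chain_relfree DE eG et Ee.
left; exists S; split=> //; rewrite (mulGSid DS).
have nDS : S \subset 'N([~: G, G]).
  by rewrite (subset_trans SG) // cents_norm.
have abelS : p.-abelem (S / [~: G, G]).
  apply: quotient_abelem; apply/abelemP=> //; split=> // x Sx.
  exact/Gp/(subsetP SG).
(* Elementary abelian p-groups of equal order are isomorphic; both orders are p^s. *)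
rewrite (isog_abelem_card _ abelS); apply/andP; split.
  apply: (@fin_lmod_pchar_abelem p 'Z_p); apply/andP; split=> //.
  by apply/eqP/pchar_Zp.
rewrite cardsT card_mx card_ord Zp_cast // mul1n card_quotient // -divgS //.
by rewrite cardS mulKn ?cardG_gt0.
Qed.
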